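(* Let $\pi\in\mathbb{R}^n\setminus\{0\}$, $\pi_0<\pi_1$ real, and $F=\{(x,t)\in\mathbb{R}^{n+1}:\pi_0\le\pi^Tx\le\pi_1\}$. Let $\beta\in\mathbb{R}$, $l\in\mathbb{R}$, let $p\ge 1$ be an integer, and let $g:\mathbb{R}^n\to\mathbb{R}$ be a positive homogeneous closed convex function. Put $$a=\frac{(|l|^p+|\pi_1|^p)^{1/p}-(|l|^p+|\pi_0|^p)^{1/p}}{\pi_1-\pi_0},\qquad b=\frac{\pi_1(|l|^p+|\pi_0|^p)^{1/p}-\pi_0(|l|^p+|\pi_1|^p)^{1/p}}{\pi_1-\pi_0},$$ $$H_{p,g}=\Bigl\{(x,t)\in\mathbb{R}^{n+1}: \bigl(g(P_\pi^\perp x)^p+|\beta\pi^Tx|^p+|\beta l|^p\bigr)^{1/p}\le t\Bigr\},$$ and assume that $H_{p,g}$ is a closed convex set. Then $\mathrm{conv}\bigl(H_{p,g}\setminus \mathrm{int}(F)\bigr)=H_{p,g}\cap C$, where $$C=\Bigl\{(x,t)\in\mathbb{R}^{n+1}: \bigl(g(P_\pi^\perp x)^p+|\beta(a\pi^Tx+b)|^p\bigr)^{1/p}\le t\Bigr\}.$$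
   Context: $P_\pi^\perp=I-\frac{\pi\pi^T}{\|\pi\|_2^2}$ is the orthogonal projection onto the orthogonal complement of $\pi$. Positive homogeneous means $g(\lambda x)=\lambda g(x)$ for all $\lambda>0$. For odd $p$ and a negative real $z$, $z^{1/p}$ denotes the real $p$-th root. $\mathrm{int}$ is the topological interior and $\mathrm{conv}$ the convex hull. *)

(* Defs.v *)
From mathcomp Require Import all_boot all_order all_algebra.
From mathcomp Require Import all_classical all_reals all_analysis.
Set Implicit Arguments.
Unset Strict Implicit.
Unset Printing Implicit Defensive.
Import Order.TTheory GRing.Theory Num.Theory.
Import numFieldNormedType.Exports.
Local Open Scope classical_set_scope.
Local Open Scope ring_scope.

(* z^(1/p): for odd p the real p-th root of any real z; for even p it is only
   meaningful at z >= 0 (its value elsewhere is a dummy). See [rrootK]. *)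
Definition rroot {R : realType} (p : nat) (z : R) : R :=
  Num.sg z * `|z| `^ (p%:R^-1).

Lemma rrootK (R : realType) (p : nat) (z : R) :
  (0 < p)%N -> odd p || (0 <= z) -> rroot p z ^+ p = z.
Proof.
move=> p0 hz; have pn0 : p%:R != 0 :> R by rewrite pnatr_eq0 -lt0n.
have -> : rroot p z ^+ p = Num.sg z ^+ p * `|z|.
  by rewrite /rroot exprMn -(powR_mulrn p (powR_ge0 _ _)) -powRrM mulVf ?powRr1.
have [z0|z0] := leP 0 z.
  rewrite ger0_norm// sgr_def; have [->|zn0] := eqVneq z 0; first by rewrite mulr0.
  by rewrite ltNge z0 /= mulr1n expr1n mul1r.
have op : odd p by move: hz; rewrite leNgt z0 orbF.
by rewrite ltr0_sg// -signr_odd op expr1 ltr0_norm// mulrNN mul1r.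
Qed.

Definition dotv {R : realType} {n : nat} (u v : 'cV[R]_n) : R :=
  (u^T *m v) 0 0.

Definition proj_perp {R : realType} {n : nat} (pi : 'cV[R]_n) : 'M[R]_n :=
  1%:M - (\sum_i pi i 0 ^+ 2)^-1 *: (pi *m pi^T).

Definition conv_hull {R : realType} {E : lmodType R} (A : set E) : set E :=
  smallest (@convex_set R E) A.

Definition pos_homogeneous {R : realType} {n : nat} (g : 'cV[R]_n -> R) : Prop :=
  forall (lambda : R) (x : 'cV[R]_n), 0 < lambda ->
    g (lambda *: x) = lambda * g x.

Definition epigraph {R : realType} {n : nat} (g : 'cV[R]_n -> R) :
    set ('cV[R]_n * R^o) :=
  [set xt | g xt.1 <= xt.2].

Definition closed_convex_function {R : realType} {n : nat}
    (g : 'cV[R]_n -> R) : Prop :=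
  closed (epigraph g) /\ convex_function [set: convex_lmodType 'cV[R]_n] g.

Section SplitSets.
Context {R : realType} {n : nat}.
Implicit Types (pi : 'cV[R]_n) (g : 'cV[R]_n -> R) (p : nat).

Definition split_set pi (pi0 pi1 : R) : set ('cV[R]_n * R^o) :=
  [set xt | pi0 <= dotv pi xt.1 <= pi1].

Definition coef_a p (l pi0 pi1 : R) : R :=
  (rroot p (`|l| ^+ p + `|pi1| ^+ p) - rroot p (`|l| ^+ p + `|pi0| ^+ p))
  / (pi1 - pi0).

Definition coef_b p (l pi0 pi1 : R) : R :=
  (pi1 * rroot p (`|l| ^+ p + `|pi0| ^+ p)
   - pi0 * rroot p (`|l| ^+ p + `|pi1| ^+ p))
  / (pi1 - pi0).

Definition Hpg p g pi (beta l : R) : set ('cV[R]_n * R^o) :=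
  [set xt | rroot p (g (proj_perp pi *m xt.1) ^+ p
                     + `|beta * dotv pi xt.1| ^+ p
                     + `|beta * l| ^+ p) <= xt.2].

Definition Cpg p g pi (beta a b : R) : set ('cV[R]_n * R^o) :=
  [set xt | rroot p (g (proj_perp pi *m xt.1) ^+ p
                     + `|beta * (a * dotv pi xt.1 + b)| ^+ p) <= xt.2].

End SplitSets.

(* Main.v *)
Require Import Defs.
From mathcomp Require Import all_boot all_order all_algebra.
From mathcomp Require Import all_classical all_reals all_analysis.
From mathcomp Require Import ring lra.
Set Implicit Arguments.
Unset Strict Implicit.
Unset Printing Implicit Defensive.
Import Order.TTheory GRing.Theory Num.Theory.
Import numFieldNormedType.Exports.
Local Open Scope classical_set_scope.
Local Open Scope ring_scope.

(** Write q(s) = (|l|^p + |s|^p)^(1/p), so that a s + b is the chord of the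
    convex function q through pi0 and pi1, and H bounds t below by
    (g^p + (|beta| q(s))^p)^(1/p) with s = pi^T x.

    Outside the split |a s + b| <= q(s), hence H \ int F lies in C.  The set C
    is convex because it is an affine preimage of
    K = {(g(P x)^p + |beta pi^T x|^p)^(1/p) <= t}, and K inherits convexity
    from H as the limit of the shrunken sets H/k.

    Conversely, let (x, t) lie in C with pi0 < s < pi1, and put r = a s + b > 0.
    Rescaling the pi-orthogonal part of x and t by q(pi_i) / r, and moving
    pi^T x to pi_i, gives points of H on the two hyperplanes bounding F; since
    r interpolates q(pi0) and q(pi1), (x, t) lies on the segment joining them. *)

(** * Signed p-th roots and the p-norm in the plane *)

Lemma rrootN (R : realType) (p : nat) (z : R) : rroot p (- z) = - rroot p z.
Proof. by rewrite /rroot sgrN normrN mulNr. Qed.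

Lemma rroot_ge0 (R : realType) (p : nat) (z : R) : 0 <= z -> 0 <= rroot p z.
Proof. by move=> z0; rewrite /rroot mulr_ge0 ?powR_ge0 ?sgr_ge0. Qed.

Lemma rrootE (R : realType) (p : nat) (z : R) :
  0 <= z -> (0 < p)%N -> rroot p z = z `^ p%:R^-1.
Proof.
move=> z0 p0; rewrite /rroot ger0_norm//; have [->|zn0] := eqVneq z 0.
  by rewrite sgr0 mul0r powR0// invr_eq0 pnatr_eq0 -lt0n.
by rewrite gtr0_sg ?mul1r// lt_def zn0.
Qed.

Lemma rroot_exp (R : realType) (p : nat) (x : R) :
  (0 < p)%N -> 0 <= x -> rroot p (x ^+ p) = x.
Proof.
move=> p0 x0; rewrite rrootE ?exprn_ge0// -powR_mulrn// -powRrM.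
by rewrite divff ?powRr1// pnatr_eq0 -lt0n.
Qed.

Lemma rroot_expK (R : realType) (p : nat) (z : R) :
  (0 < p)%N -> 0 <= z -> rroot p z ^+ p = z.
Proof. by move=> p0 z0; rewrite rrootK// z0 orbT. Qed.

(** Negative [z] reduces to positive [z] by oddness. It has to be covered because [g] may be
    negative, so that for odd [p] the radicand may be negative. *)
Lemma rrootM (R : realType) (p : nat) (c z : R) :
  (0 < p)%N -> 0 <= c -> rroot p (c ^+ p * z) = c * rroot p z.
Proof.
move=> p0 c0; have c0p : 0 <= c ^+ p by exact: exprn_ge0.
wlog z0 : z / 0 <= z => [hw|].
  have [/hw//|/ltW z0] := leP 0 z.
  by have := hw (- z); rewrite oppr_ge0 mulrN !rrootN mulrN => /(_ z0)/oppr_inj.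
by rewrite !rrootE ?mulr_ge0// powRM// -(@rrootE _ p (c ^+ p))// rroot_exp.
Qed.

Lemma ler_rroot (R : realType) (p : nat) (y z : R) :
  (0 < p)%N -> y <= z -> rroot p y <= rroot p z.
Proof.
move=> p0 yz.
have mono u v : 0 <= u -> u <= v -> rroot p u <= rroot p v.
  move=> u0 uv; have v0 := le_trans u0 uv.
  by rewrite !rrootE// ge0_ler_powR// ?nnegrE// invr_ge0.
have [y0|y0] := leP 0 y; first exact: mono.
have [z0|z0] := leP 0 z.
  apply: (@le_trans _ _ 0); last exact: rroot_ge0.
  by rewrite -oppr_ge0 -rrootN rroot_ge0// oppr_ge0 ltW.
by rewrite -lerN2 -!rrootN mono ?lerN2// oppr_ge0 ltW.
Qed.

Lemma rroot_surj (R : realType) (p : nat) (w : R) :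
  (0 < p)%N -> exists z, rroot p z = w.
Proof.
move=> p0; have [w0|w0] := leP 0 w; first by exists (w ^+ p); rewrite rroot_exp.
by exists (- (- w) ^+ p); rewrite rrootN rroot_exp ?opprK// oppr_ge0 ltW.
Qed.

(** A preimage of [rroot p z + e] must exceed [z] by monotonicity, so surjectivity already gives
    continuity from the right. *)
Lemma rroot_right_cont (R : realType) (p : nat) (z e : R) :
  (0 < p)%N -> 0 < e -> exists2 d, 0 < d & rroot p (z + d) <= rroot p z + e.
Proof.
move=> p0 e0; have [w wE] := rroot_surj (rroot p z + e) p0.
exists (w - z); last by rewrite addrC subrK wE.
rewrite subr_gt0 ltNge; apply/negP => /(ler_rroot p0).
by rewrite wE gerDl leNgt e0.
Qed.

(* With [A], [B] the two norms on the right, divide by [A + B] and use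
   convexity of the power with weights A/(A+B), B/(A+B). *)
Lemma rroot_minkowski (R : realType) (p : nat) (x y u v : R) :
  (0 < p)%N -> 0 <= x -> 0 <= y -> 0 <= u -> 0 <= v ->
  rroot p ((x + u) ^+ p + (y + v) ^+ p) <=
  rroot p (x ^+ p + y ^+ p) + rroot p (u ^+ p + v ^+ p).
Proof.
move=> p0 x0 y0 u0 v0.
have xy0 : 0 <= x ^+ p + y ^+ p by rewrite addr_ge0 ?exprn_ge0.
have uv0 : 0 <= u ^+ p + v ^+ p by rewrite addr_ge0 ?exprn_ge0.
set A := rroot p (x ^+ p + y ^+ p); set B := rroot p (u ^+ p + v ^+ p).
have AE : A ^+ p = x ^+ p + y ^+ p by rewrite rroot_expK.
have BE : B ^+ p = u ^+ p + v ^+ p by rewrite rroot_expK.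
have A0 : 0 <= A by exact: rroot_ge0.
have B0 : 0 <= B by exact: rroot_ge0.
clearbody A B.
have zero c d : 0 <= c -> 0 <= d -> 0 = c ^+ p + d ^+ p -> c = 0 /\ d = 0.
  move=> c0 d0 /esym/eqP; rewrite paddr_eq0 ?exprn_ge0// !expf_eq0 p0/=.
  by move=> /andP[/eqP-> /eqP->].
(* If one norm vanishes, so do both of its coordinates, and equality holds; afterwards division by
   [A] and [B] is legitimate. *)
have [A00|An0] := eqVneq A 0.
  have [-> ->] : x = 0 /\ y = 0.
    by apply: zero => //; rewrite -AE A00 expr0n eqn0Ngt p0.
  by rewrite !add0r A00 add0r -BE rroot_exp.
have [B00|Bn0] := eqVneq B 0.
  have [-> ->] : u = 0 /\ v = 0.
    by apply: zero => //; rewrite -BE B00 expr0n eqn0Ngt p0.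
  by rewrite !addr0 B00 addr0 -AE rroot_exp.
have Agt0 : 0 < A by rewrite lt_def An0.
have Bgt0 : 0 < B by rewrite lt_def Bn0.
have M0 : 0 < A + B by rewrite addr_gt0.
have t01 : 0 <= A / (A + B) <= 1.
  by rewrite divr_ge0 ?addr_ge0//= ler_pdivrMr// mul1r lerDl.
pose t : {i01 R} := Itv01 (proj1 (andP t01)) (proj2 (andP t01)).
have cvx c d : 0 <= c -> 0 <= d ->
    (c + d) ^+ p / (A + B) ^+ p <=
    A / (A + B) * (c ^+ p / A ^+ p) + B / (A + B) * (d ^+ p / B ^+ p).
  move=> c0 d0; have cA : 0 <= c / A by rewrite divr_ge0.
  have dB : 0 <= d / B by rewrite divr_ge0.
  have p1 : 1 <= p%:R :> R by rewrite ler1n.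
  have : (A / (A + B) * (c / A) + (1 - A / (A + B)) * (d / B)) `^ p%:R <=
      A / (A + B) * (c / A) `^ p%:R + (1 - A / (A + B)) * (d / B) `^ p%:R.
    by apply: (@convex_powR R p%:R p1 t); rewrite inE/= in_itv/= andbT.
  have -> : 1 - A / (A + B) = B / (A + B) by field; rewrite gt_eqF.
  have -> : A / (A + B) * (c / A) + B / (A + B) * (d / B) = (c + d) / (A + B).
    by field; rewrite An0 Bn0 gt_eqF.
  by rewrite !powR_mulrn ?divr_ge0 ?addr_ge0// !expr_div_n.
rewrite -[leRHS](@rroot_exp _ p)// ?addr_ge0//; apply: ler_rroot => //.
have Mp : 0 < (A + B) ^+ p by rewrite exprn_gt0.
rewrite -[leRHS]mul1r -ler_pdivrMr// mulrDl.
apply: le_trans (lerD (cvx x u x0 u0) (cvx y v y0 v0)) _.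
rewrite addrACA -!mulrDr -!mulrDl -AE -BE.
have An : A ^+ p != 0 by rewrite expf_neq0.
have Bn : B ^+ p != 0 by rewrite expf_neq0.
by rewrite !divff// !mulr1 -mulrDl divff// gt_eqF.
Qed.

(** * The chord of q, inside and outside the split *)

(** Here [q0], [q1], [qs] stand for q at [x0], [x1], [s], with denominators cleared. The upper bound
    is convexity. For the lower one, the chord has slope at most 1, so at [s] it is at least q0 -
    (x0 - s) >= s >= -qs. *)
Lemma chord_bound_left (R : realFieldType) (x0 x1 s q0 q1 qs : R) :
  s <= x0 -> x0 <= x1 -> x0 <= q0 -> - s <= qs -> q1 <= q0 + (x1 - x0) ->
  (x1 - s) * q0 <= (x1 - x0) * qs + (x0 - s) * q1 ->
  (- ((x1 - s) * q0 + (s - x0) * q1) <= qs * (x1 - x0)) &&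
  ((x1 - s) * q0 + (s - x0) * q1 <= qs * (x1 - x0)).
Proof.
move=> sx0 x01 x0q sq q10 c.
have k1 : 0 <= (x0 - s) * (q0 + (x1 - x0) - q1) by rewrite mulr_ge0 ?subr_ge0.
have k2 : 0 <= (x1 - x0) * (qs - - s) by rewrite mulr_ge0 ?subr_ge0.
have k3 : 0 <= (x1 - x0) * (q0 - x0) by rewrite mulr_ge0 ?subr_ge0.
by apply/andP; split; lra.
Qed.

(** Mirror image: slope at least -1 puts the chord at [s] above q1 - (s - x1) >= -s >= -qs. *)
Lemma chord_bound_right (R : realFieldType) (x0 x1 s q0 q1 qs : R) :
  x0 <= x1 -> x1 <= s -> - x1 <= q1 -> s <= qs -> q0 <= q1 + (x1 - x0) ->
  (s - x0) * q1 <= (s - x1) * q0 + (x1 - x0) * qs ->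
  (- ((x1 - s) * q0 + (s - x0) * q1) <= qs * (x1 - x0)) &&
  ((x1 - s) * q0 + (s - x0) * q1 <= qs * (x1 - x0)).
Proof.
move=> x01 x1s x1q sq q01 c.
have k1 : 0 <= (s - x1) * (q1 + (x1 - x0) - q0) by rewrite mulr_ge0 ?subr_ge0.
have k2 : 0 <= (x1 - x0) * (qs - s) by rewrite mulr_ge0 ?subr_ge0.
have k3 : 0 <= (x1 - x0) * (q1 - - x1) by rewrite mulr_ge0 ?subr_ge0.
by apply/andP; split; lra.
Qed.

Section Chord.
Context {R : realType}.
Variables (p : nat) (l : R).
Hypothesis p0 : (0 < p)%N.

Let q (s : R) := rroot p (`|l| ^+ p + `|s| ^+ p).

Let q_ge0 s : 0 <= q s.
Proof. by rewrite rroot_ge0// addr_ge0// exprn_ge0. Qed.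

Let q_ge_norm s : `|s| <= q s.
Proof.
by rewrite -[leLHS](rroot_exp p0)// ler_rroot// lerDr exprn_ge0.
Qed.

(** Since [q s] is the p-norm of (l, s), this is Minkowski for (w - v)(|l|, |u|) and (v - u)(|l|,
    |w|), followed by the triangle inequality in the second coordinate. *)
Let q_convex u v w : u <= v -> v <= w ->
  (w - u) * q v <= (w - v) * q u + (v - u) * q w.
Proof.
move=> uv vw; have uw := le_trans uv vw.
rewrite -!rrootM ?subr_ge0// !mulrDr -!exprMn.
have := @rroot_minkowski R p ((w - v) * `|l|) ((w - v) * `|u|)
  ((v - u) * `|l|) ((v - u) * `|w|) p0.
rewrite !mulr_ge0 ?subr_ge0// => /(_ isT isT isT isT); apply: le_trans.
rewrite ler_rroot// -mulrDl addrA subrK lerD2l lerXn2r//.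
- by rewrite nnegrE mulr_ge0 ?subr_ge0.
- by rewrite nnegrE addr_ge0// mulr_ge0 ?subr_ge0.
have nM c d : 0 <= c -> c * `|d| = `|c * d|.
  by move=> c0; rewrite normrM ger0_norm.
rewrite !nM ?subr_ge0//; apply: le_trans (ler_normD _ _).
by rewrite le_eqVlt; apply/orP; left; apply/eqP; congr `|_|; ring.
Qed.

(** Minkowski for (|l|, |v|) and (0, |u - v|). *)
Let q_lip u v : q u <= q v + `|u - v|.
Proof.
have := @rroot_minkowski R p `|l| `|v| 0 `|u - v| p0.
rewrite !normr_ge0 lexx expr0n eqn0Ngt p0 add0r rroot_exp//.
move=> /(_ isT isT isT isT); apply: le_trans; rewrite addr0 ler_rroot//.
rewrite lerD2l lerXn2r// ?nnegrE ?addr_ge0// -[X in `|X|](subrK v u) addrC.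
exact: ler_normD.
Qed.

Variables pi0 pi1 : R.
Hypothesis lt_pi : pi0 < pi1.

Let a := coef_a p l pi0 pi1.
Let b := coef_b p l pi0 pi1.

Lemma chordE s :
  a * s + b = (pi1 - s) / (pi1 - pi0) * q pi0 + (s - pi0) / (pi1 - pi0) * q pi1.
Proof.
rewrite /a /b /coef_a /coef_b -/(q pi0) -/(q pi1); field.
by rewrite subr_eq0 gt_eqF.
Qed.

Lemma chord_outside s : s <= pi0 \/ pi1 <= s -> `|a * s + b| <= q s.
Proof.
have d0 : 0 < pi1 - pi0 by rewrite subr_gt0.
have dn : `|pi1 - pi0| = pi1 - pi0 by rewrite ger0_norm// ltW.
have l10 := q_lip pi1 pi0; have l01 := q_lip pi0 pi1.
rewrite distrC dn in l01; rewrite dn in l10.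
have n0 := le_trans (ler_norm _) (q_ge_norm pi0).
have m1 : - pi1 <= q pi1.
  by apply: le_trans (q_ge_norm _); rewrite -normrN ler_norm.
have ns := le_trans (ler_norm _) (q_ge_norm s).
have ms : - s <= q s by apply: le_trans (q_ge_norm _); rewrite -normrN ler_norm.
have E : (a * s + b) * (pi1 - pi0) = (pi1 - s) * q pi0 + (s - pi0) * q pi1.
  by rewrite chordE; field; rewrite gt_eqF.
move=> hs; rewrite ler_norml -lerNl.
rewrite -(ler_pM2r d0) mulNr E -[X in _ && X](ler_pM2r d0) E.
case: hs => hs.
- exact: (chord_bound_left hs (ltW lt_pi) n0 ms l10 (q_convex hs (ltW lt_pi))).
- exact: (chord_bound_right (ltW lt_pi) hs m1 ns l01 (q_convex (ltW lt_pi) hs)).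
Qed.

(** Both weights are positive, and [pi0], [pi1] are not both zero, so at least one of the two values
    of q is positive even when [l] is 0. *)
Lemma chord_inside_gt0 s : pi0 < s -> s < pi1 -> 0 < a * s + b.
Proof.
move=> s0 s1; rewrite chordE.
have d0 : 0 < pi1 - pi0 by rewrite subr_gt0.
have c0 : 0 < (pi1 - s) / (pi1 - pi0) by rewrite divr_gt0 ?subr_gt0.
have c1 : 0 < (s - pi0) / (pi1 - pi0) by rewrite divr_gt0 ?subr_gt0.
have q_gt0 u : u != 0 -> 0 < q u.
  by move=> un0; apply: lt_le_trans (q_ge_norm u); rewrite normr_gt0.
have [pi00|pi0n0] := eqVneq pi0 0.
  apply: ltr_wpDl; first by rewrite mulr_ge0// ltW.
  by rewrite mulr_gt0// q_gt0// -pi00 gt_eqF.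
apply: ltr_pwDl; last by rewrite mulr_ge0// ltW.
by rewrite mulr_gt0// q_gt0.
Qed.

End Chord.

(** * Orthogonal decomposition along [pi] and the interior of the split *)

Section SplitGeometry.
Context {R : realType} {n : nat}.
Variable pi : 'cV[R]_n.
Implicit Types (x y : 'cV[R]_n) (s k : R).

Lemma dotvE x y : dotv x y = \sum_i x i 0 * y i 0.
Proof. by rewrite /dotv mxE; apply: eq_bigr => i _; rewrite mxE. Qed.

Lemma dotvD x y z : dotv x (y + z) = dotv x y + dotv x z.
Proof. by rewrite /dotv mulmxDr mxE. Qed.

Lemma dotvZ x k y : dotv x (k *: y) = k * dotv x y.
Proof. by rewrite /dotv -scalemxAr mxE. Qed.

Lemma dotvv_gt0 : pi != 0 -> 0 < dotv pi pi.
Proof.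
move=> pi_neq0; rewrite dotvE lt_def sumr_ge0 ?andbT; last first.
  by move=> i _; rewrite -expr2 sqr_ge0.
apply: contra_neq pi_neq0 => /eqP.
rewrite psumr_eq0 => [/allP h|i _]; last by rewrite -expr2 sqr_ge0.
apply/colP => i; rewrite mxE; apply/eqP; rewrite -sqrf_eq0 expr2.
exact: (implyP (h i (mem_index_enum _))).
Qed.

Lemma proj_perpE x :
  proj_perp pi *m x = x - (dotv pi x / dotv pi pi) *: pi.
Proof.
rewrite /proj_perp mulmxBl mul1mx -scalemxAl -mulmxA [pi^T *m x]mx11_scalar.
rewrite -/(dotv pi x) mul_mx_scalar scalerA mulrC (dotvE pi pi).
by under eq_bigr do rewrite expr2.
Qed.

Hypothesis pi_neq0 : pi != 0.

Lemma dotv_proj_perp x : dotv pi (proj_perp pi *m x) = 0.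
Proof.
rewrite proj_perpE dotvD -scaleNr dotvZ mulNr divfK ?subrr//.
by rewrite gt_eqF// dotvv_gt0.
Qed.

(** Keeps the component of [x] orthogonal to [pi] and resets [pi^T x] to [s]; it is linear in the
    pair (s, x). *)
Definition lift_perp s x : 'cV[R]_n :=
  proj_perp pi *m x + (s / dotv pi pi) *: pi.

Lemma dotv_lift_perp s x : dotv pi (lift_perp s x) = s.
Proof.
rewrite /lift_perp dotvD dotv_proj_perp add0r dotvZ divfK//.
by rewrite gt_eqF// dotvv_gt0.
Qed.

Lemma proj_lift_perp s x :
  proj_perp pi *m lift_perp s x = proj_perp pi *m x.
Proof. by rewrite proj_perpE dotv_lift_perp addrK. Qed.

Lemma lift_perp_id x : lift_perp (dotv pi x) x = x.
Proof. by rewrite /lift_perp proj_perpE subrK. Qed.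

Lemma lift_perp_conv k s1 s2 x y :
  lift_perp (k * s1 + (1 - k) * s2) (k *: x + (1 - k) *: y) =
  k *: lift_perp s1 x + (1 - k) *: lift_perp s2 y.
Proof.
rewrite /lift_perp mulmxDr -!scalemxAr !scalerDr addrACA; congr (_ + _).
by rewrite !scalerA -scalerDl mulrDl !mulrA.
Qed.

Lemma interior_split_set (pi0 pi1 : R) :
  interior (split_set pi pi0 pi1) =
  [set xt : 'cV[R]_n * R^o | pi0 < dotv pi xt.1 < pi1].
Proof.
have dot_cont : continuous (fun xt : 'cV[R]_n * R^o => dotv pi xt.1).
  rewrite [X in continuous X](_ : _ = fun xt : 'cV[R]_n * R^o =>
      \sum_i pi i 0 * xt.1 i 0); last by apply/funext => xt; rewrite dotvE.
  move=> xt; apply: cvg_big => [|i _]; first exact: add_continuous.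
  apply: cvgMr.
  apply: (continuous_comp (f := fst) (g := fun y : 'cV[R]_n => y i 0)).
    exact: cvg_fst.
  exact: coord_continuous.
have v0 := dotvv_gt0 pi_neq0.
apply/seteqP; split=> [[x t] xin | ]; last first.
  rewrite -open_subsetE.
    by move=> xt /= /andP[h0 h1]; apply/andP; split; exact: ltW.
  rewrite (_ : mkset _ = (fun xt : 'cV[R]_n * R^o => dotv pi xt.1) @^-1`
    ([set s | pi0 < s] `&` [set s | s < pi1])); last first.
    by apply/seteqP; split=> xt /= => [/andP[]|[-> ->]].
  apply: open_comp; first by move=> xt _; exact: dot_cont.
  by apply: openI; [exact: open_gt | exact: open_lt].
(* An interior point can be moved a little along [pi] in both directions without leaving the split,
   which makes both inequalities strict. *)
have path_cont : (fun e : R => (x + e *: pi, t) : 'cV[R]_n * R^o) @ (0 : R)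
   --> ((x, t) : 'cV[R]_n * R^o).
  apply: (@cvg_pair _ _ _ _ (nbhs x) (nbhs (t : R^o))); last exact: cvg_cst.
  rewrite -[in nbhs x](addr0 x) -(scale0r pi).
  apply: cvgD; first exact: cvg_cst.
  apply: cvgZr_tmp; exact: cvg_id.
have /nbhs_ballP[e /= e0 he] :
    nbhs (0 : R) [set d | split_set pi pi0 pi1 (x + d *: pi, t)].
  exact: path_cont _ xin.
have hpath d : `|d| < e -> pi0 <= dotv pi x + d * dotv pi pi <= pi1.
  move=> de; rewrite -dotvZ -dotvD; apply: (he d).
  by rewrite /ball/= sub0r normrN.
have e2 : 0 < e / 2 by rewrite divr_gt0.
have e2e : e / 2 < e by rewrite ltr_pdivrMr// ltr_pMr// ltr1n.
have ev : 0 < e / 2 * dotv pi pi by rewrite mulr_gt0.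
have /andP[_ h1] : pi0 <= dotv pi x + (e / 2) * dotv pi pi <= pi1.
  by apply: hpath; rewrite gtr0_norm.
have /andP[h0 _] : pi0 <= dotv pi x + (- (e / 2)) * dotv pi pi <= pi1.
  by apply: hpath; rewrite normrN gtr0_norm.
rewrite /=; apply/andP; split.
  by apply: le_lt_trans h0 _; rewrite mulNr gtrDl oppr_lt0.
by apply: lt_le_trans h1; rewrite ltrDl.
Qed.

End SplitGeometry.

(** * Removing the constant term by scaling *)

(* If (x, t) is in the second set, then (k x, k (t + e)) is in the first one for
   k large, because the constant [c] scales as c / k^p. *)
Lemma recession_convex (R : realType) (E : lmodType R) (p : nat) (c : R)
    (Q : E -> R) : (0 < p)%N -> 0 <= c ->
  (forall k x, 0 < k -> Q (k *: x) = k ^+ p * Q x) ->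
  convex_set [set xt : E * R^o | rroot p (Q xt.1 + c) <= xt.2] ->
  convex_set [set xt : E * R^o | rroot p (Q xt.1) <= xt.2].
Proof.
move=> p0 c0 Qk cvx [x t] [y u] lam; rewrite !inE /= => xt yu.
apply/ler_addgt0Pr => e e0.
have [d1 d1_gt0 hd1] := rroot_right_cont (Q x) p0 e0.
have [d2 d2_gt0 hd2] := rroot_right_cont (Q y) p0 e0.
(* As k >= 1, also k <= k^p; hence c / k^p is at most both [d1] and [d2]. *)
pose k := 1 + c / d1 + c / d2.
have cd1 : 0 <= c / d1 by rewrite divr_ge0// ltW.
have cd2 : 0 <= c / d2 by rewrite divr_ge0// ltW.
have k1 : 1 <= k by rewrite /k -addrA lerDl addr_ge0.
have k0 : 0 < k by exact: lt_le_trans k1.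
have kp : k <= k ^+ p by rewrite -[leLHS]expr1 ler_weXn2l.
have kp0 : 0 < k ^+ p by rewrite exprn_gt0.
have kd d : 0 < d -> c / d <= k -> c / k ^+ p <= d.
  move=> d0 h; rewrite ler_pdivrMr// mulrC -ler_pdivrMr//; exact: le_trans kp.
have Hk z d v : c / k ^+ p <= d -> rroot p (Q z) <= v ->
    rroot p (Q z + d) <= rroot p (Q z) + e ->
    rroot p (Q (k *: z) + c) <= k * (v + e).
  move=> cd zv zd; rewrite Qk// -[c](divfK (lt0r_neq0 kp0)) [_ / _ * _]mulrC.
  rewrite -mulrDr rrootM ?(ltW k0)// ler_pM2l//.
  have : rroot p (Q z + c / k ^+ p) <= rroot p (Q z + d).
    by rewrite ler_rroot// lerD2l.
  by move/le_trans/(_ zd)/le_trans; apply; rewrite lerD2r.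
have kx : c / k ^+ p <= d1 by apply: kd => //; rewrite /k addrAC lerDr addr_ge0.
have ky : c / k ^+ p <= d2 by apply: kd => //; rewrite /k lerDr addr_ge0.
have := cvx (k *: x, k * (t + e)) (k *: y, k * (u + e)) lam.
rewrite !inE/= => /(_ (Hk _ _ _ kx xt hd1) (Hk _ _ _ ky yu hd2)).
have -> : lam%:num *: (k *: x) + unstable.onem lam%:num *: (k *: y) =
    k *: (lam%:num *: x + unstable.onem lam%:num *: y).
  by rewrite scalerDr !scalerA ![_ * k]mulrC.
have -> : lam%:num *: (k * (t + e) : R^o) +
    unstable.onem lam%:num *: (k * (u + e) : R^o) =
    k * (lam%:num * t + unstable.onem lam%:num * u + e).
  by rewrite /unstable.onem /GRing.scale/=; ring.
(* Scale back by 1/k and drop the nonnegative constant [c]. *)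
move=> hz; rewrite -(ler_pM2l k0) -rrootM ?(ltW k0)// -Qk//.
by apply: le_trans hz; rewrite ler_rroot// lerDl.
Qed.

(** * Convexity of C, and scaling points of C into H *)

Section Cut.
Context {R : realType} {n : nat}.
Variables (pi : 'cV[R]_n) (beta l : R) (p : nat) (g : 'cV[R]_n -> R).
Hypotheses (pi_neq0 : pi != 0) (p0 : (0 < p)%N) (g_homo : pos_homogeneous g).

(** The case k = 0 holds because g(0) = g(2 * 0) = 2 g(0). It occurs when [l] and an endpoint of the
    split are both 0. *)
Lemma pos_homogeneous_ge0 k x : 0 <= k -> g (k *: x) = k * g x.
Proof.
rewrite le_eqVlt => /orP[/eqP <-|/g_homo//]; rewrite scale0r mul0r.
have := g_homo 0 (@ltr0n R 2); rewrite scaler0 => /eqP.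
rewrite -subr_eq0 -{1}[g 0]mul1r -mulrBl mulf_eq0 => /orP[|/eqP//].
by rewrite subr_eq0 => /eqP h; have := @ltr1n R 2; rewrite -h ltxx.
Qed.

Lemma Cpg_convex (a b : R) :
  convex_set (Hpg p g pi beta l) -> convex_set (Cpg p g pi beta a b).
Proof.
move=> Hcvx.
pose Q (x : 'cV[R]_n) := g (proj_perp pi *m x) ^+ p + `|beta * dotv pi x| ^+ p.
have Kcvx : convex_set [set xt : 'cV[R]_n * R^o | rroot p (Q xt.1) <= xt.2].
  apply: (@recession_convex _ _ p (`|beta * l| ^+ p)) => //.
  move=> k x k0; rewrite /Q -scalemxAr g_homo// dotvZ mulrCA normrM.
  by rewrite (gtr0_norm k0) !exprMn mulrDr.
(* The affine map pulling K back to C replaces [pi^T x] by [a * pi^T x + b] and fixes the orthogonal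
   part. *)
have CK x t : Cpg p g pi beta a b (x, t) <->
    rroot p (Q (lift_perp pi (a * dotv pi x + b) x)) <= t.
  by rewrite /Q dotv_lift_perp// proj_lift_perp.
move=> [x t] [y u] lam; rewrite !inE => /CK xt /CK yu.
have := Kcvx (lift_perp pi (a * dotv pi x + b) x, t)
  (lift_perp pi (a * dotv pi y + b) y, u) lam.
rewrite !inE/= => /(_ xt yu); rewrite /= -lift_perp_conv => h.
apply/CK; rewrite dotvD !dotvZ; apply: le_trans h.
by rewrite (_ : a * _ + b = lam%:num * (a * dotv pi x + b) +
  (1 - lam%:num) * (a * dotv pi y + b))//; rewrite /unstable.onem; ring.
Qed.

Lemma HpgE x t : Hpg p g pi beta l (x, t) <->
  rroot p (g (proj_perp pi *m x) ^+ p +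
    (`|beta| * rroot p (`|l| ^+ p + `|dotv pi x| ^+ p)) ^+ p) <= t.
Proof.
rewrite /Hpg/= exprMn rroot_expK// ?addr_ge0 ?exprn_ge0//.
by rewrite mulrDr -!exprMn -!normrM addrAC addrA.
Qed.

(** With r = a pi^T x + b and q(s) = k r, the inequality for H at the new point is [k] times the
    inequality for C at (x, t). *)
Lemma Hpg_scaled (a b : R) x t s :
  Cpg p g pi beta a b (x, t) -> 0 < a * dotv pi x + b ->
  let k := rroot p (`|l| ^+ p + `|s| ^+ p) / (a * dotv pi x + b) in
  Hpg p g pi beta l (lift_perp pi s (k *: x), k * t).
Proof.
move=> Cxt r0 k.
have k0 : 0 <= k.
  by rewrite divr_ge0 ?(ltW r0)// rroot_ge0// addr_ge0 ?exprn_ge0.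
apply/HpgE; rewrite dotv_lift_perp// proj_lift_perp// -scalemxAr.
rewrite pos_homogeneous_ge0// -[rroot p (_ + `|s| ^+ p)](divfK (lt0r_neq0 r0)).
rewrite -/k; clearbody k.
rewrite mulrCA !exprMn -mulrDr rrootM// ler_wpM2l// -exprMn.
by rewrite -[X in _ * X](gtr0_norm r0) -normrM.
Qed.

End Cut.

(** * The two inclusions between the hull and the cut set *)

Theorem proposition3p5 (R : realType) (n : nat) (pi : 'cV[R]_n)
    (pi0 pi1 beta l : R) (p : nat) (g : 'cV[R]_n -> R)
    (pi_neq0 : pi != 0) (lt_pi : pi0 < pi1) (p_ge1 : (1 <= p)%N)
    (g_homo : pos_homogeneous g) (g_cc : closed_convex_function g)
    (H_closed : closed (Hpg p g pi beta l))
    (H_convex : convex_set (Hpg p g pi beta l)) :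
  let a := coef_a p l pi0 pi1 in
  let b := coef_b p l pi0 pi1 in
  conv_hull (Hpg p g pi beta l `\` interior (split_set pi pi0 pi1)) =
  Hpg p g pi beta l `&` Cpg p g pi beta a b.
Proof.
move=> a b; rewrite interior_split_set//; apply/seteqP; split.
- apply: smallest_sub.
    have C_convex := Cpg_convex (a := a) (b := b) pi_neq0 p_ge1 g_homo H_convex.
    move=> u v lam; rewrite !inE => -[Hu Cu] [Hv Cv].
    by split; apply/set_mem; [apply: H_convex|apply: C_convex]; rewrite inE.
  move=> [x t] [Hxt /= out]; split=> //.
  have : dotv pi x <= pi0 \/ pi1 <= dotv pi x.
    have [|h0] := leP (dotv pi x) pi0; first by left.
    have [|h1] := leP pi1 (dotv pi x); first by right.
    by case: out; rewrite h0 h1.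
  move=> /(chord_outside l p_ge1 lt_pi) cs.
  move/HpgE: Hxt => /(_ p_ge1); apply: le_trans; rewrite /= ler_rroot// lerD2l.
  have q0 := le_trans (normr_ge0 _) cs.
  by rewrite normrM lerXn2r ?nnegrE ?(mulr_ge0 (normr_ge0 beta))// ler_wpM2l.
(* The hull is the intersection of all convex [A] containing H \ int F, so membership is checked in
   each of them. *)
- move=> [x t] [Hxt Cxt] A [A_convex subA].
  have [inside|outside] := boolP (pi0 < dotv pi x < pi1); last first.
    by apply: subA; split=> //=; exact/negP.
  case/andP: inside; set s := dotv pi x => s0 s1.
  have r0 : 0 < a * s + b by exact: chord_inside_gt0.
  have d0 : 0 < pi1 - pi0 by rewrite subr_gt0.
  have lam01 : 0 <= (pi1 - s) / (pi1 - pi0) <= 1.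
    rewrite divr_ge0 ?(ltW d0) ?subr_ge0 ?(ltW s1)//= ler_pdivrMr// mul1r.
    by rewrite lerD2l lerN2 ltW.
  (* The weight for which [s] is the combination of [pi0] and [pi1]. *)
  pose lam : {i01 R} := Itv01 (proj1 (andP lam01)) (proj2 (andP lam01)).
  have lamE : lam%:num = (pi1 - s) / (pi1 - pi0) by [].
  have lamCE : 1 - lam%:num = (s - pi0) / (pi1 - pi0).
    by rewrite lamE; field; rewrite subr_eq0 gt_eqF.
  clearbody lam.
  pose q (u : R) : R := rroot p (`|l| ^+ p + `|u| ^+ p).
  pose k (u : R) : R := q u / (a * s + b).
  have inA u : u <= pi0 \/ pi1 <= u -> A (lift_perp pi u (k u *: x), k u * t).
    move=> hu; apply: subA; split; first exact: Hpg_scaled.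
    rewrite /= dotv_lift_perp// => /andP[u0 u1].
    by case: hu => hu; [move: u0|move: u1]; rewrite ltNge hu.
  have := A_convex (lift_perp pi pi0 (k pi0 *: x), k pi0 * t)
    (lift_perp pi pi1 (k pi1 *: x), k pi1 * t) lam.
  rewrite !inE => /(_ (inA _ (or_introl (lexx _))) (inA _ (or_intror (lexx _)))).
  suff -> : conv lam ((lift_perp pi pi0 (k pi0 *: x), k pi0 * t) :
      convex_lmodType ('cV[R]_n * R^o)%type)
    (lift_perp pi pi1 (k pi1 *: x), k pi1 * t) = (x, t) by [].
  have kE u : k u * (a * s + b) = q u by rewrite divfK// lt0r_neq0.
  have rE : a * s + b = lam%:num * q pi0 + (1 - lam%:num) * q pi1.
    by rewrite lamCE lamE; exact: chordE.
  clearbody k q.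
  (* Interpolation of r by [q pi0] and [q pi1], divided by r: the two scalings average to 1, so the
     combination restores [t] and the orthogonal part of [x]. *)
  have lamk : lam%:num * k pi0 + (1 - lam%:num) * k pi1 = 1.
    by apply: (mulIf (lt0r_neq0 r0)); rewrite mul1r [RHS]rE -!kE; ring.
  have lams : lam%:num * pi0 + (1 - lam%:num) * pi1 = s.
    by rewrite lamCE lamE; field; rewrite subr_eq0 gt_eqF.
  rewrite [LHS]surjective_pairing; congr pair; last first.
    by rewrite /= /GRing.scale/= !mulrA -mulrDl lamk mul1r.
  rewrite /= -lift_perp_conv !scalerA -scalerDl.
  by rewrite lamk lams scale1r lift_perp_id.
Qed.
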